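(* Let $S$ be a restriction semigroup. Let $\widehat{I}\colon\widehat{\mathcal{A}}(S)\to\mathcal{A}(S)$ and $\widetilde{I}\colon\widetilde{\mathcal{A}}(S)\to\mathcal{A}(S)$ be the inclusion functors, let $\widehat{F}\colon\mathcal{A}(S)\to\widehat{\mathcal{A}}(S)$ be the extension of domains functor and $\widetilde{F}\colon\mathcal{A}(S)\to\widetilde{\mathcal{A}}(S)$ the restriction of domains functor. Then: (1) $\widehat{F}$ is a left adjoint to $\widehat{I}$; (2) $\widetilde{F}$ is a right adjoint to $\widetilde{I}$; (3) the functors $\widetilde{F}\widehat{I}\colon\widehat{\mathcal{A}}(S)\to\widetilde{\mathcal{A}}(S)$ and $\widehat{F}\widetilde{I}\colon\widetilde{\mathcal{A}}(S)\to\widehat{\mathcal{A}}(S)$ establish an isomorphism between the categories $\widehat{\mathcal{A}}(S)$ and $\widetilde{\mathcal{A}}(S)$.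
   Context: A restriction semigroup is an algebra $(S;\cdot,{}^*,{}^+)$ of type $(2,1,1)$ such that $(S;\cdot)$ is a semigroup and the following identities hold: $x^+x=x$, $x^+y^+=y^+x^+$, $(x^+y)^+=x^+y^+$, $(xy)^+x=xy^+$; $xx^*=x$, $x^*y^*=y^*x^*$, $(xy^* )^*=x^*y^*$, $y(xy)^*=x^*y$; $(x^+)^*=x^+$, $(x^* )^+=x^*$. $P(S)=\{s^*\colon s\in S\}=\{s^+\colon s\in S\}$ is the semilattice of projections. The natural partial order is: $s\le t$ iff $s=et$ for some $e\in P(S)$. Inverse semigroups are restriction semigroups via $s^*=s^{-1}s$, $s^+=ss^{-1}$. $\mathcal{I}(X)$ is the symmetric inverse semigroup of all partial bijections of $X$, composed from right to left. For a subset $B$ of a poset, $B^\downarrow$ is the set of elements lying below some element of $B$, and $b^\downarrow=\{b\}^\downarrow$. A premorphism $\varphi\colon S\to T$ between restriction semigroups is a map with $\varphi(s)\varphi(t)\le\varphi(st)$, $\varphi(s)^*\le\varphi(s^* )$ and $\varphi(s)^+\le\varphi(s^+)$ for all $s,t\in S$. For $T=\mathcal{I}(X)$ we write $\varphi_s$ for $\varphi(s)$. The category $\mathcal{A}(S)$: objects are triples $(\alpha,p,X)$ where $X$ is a semilattice, $p\colon X\to P(S)$ is a semilattice morphism and $\alpha\colon S\to\mathcal{I}(X)$ is a premorphism such that: (A1) for all $s\in S$, $\operatorname{dom}\alpha_s$ and $\operatorname{ran}\alpha_s$ are order ideals of $X$; (A2) for all $s\in S$, $\alpha_s$ is an order isomorphism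 (from its domain onto its range); (A3) for all $e\in P(S)$, $(p^{-1}(e))^\downarrow\subseteq\operatorname{dom}\alpha_e\subseteq p^{-1}(e^\downarrow)$; (A4) for all $s\in S$, $\operatorname{dom}\alpha_s\cap p^{-1}(s^* )\ne\varnothing$. A morphism from $(\alpha,p_\alpha,X)$ to $(\beta,p_\beta,Y)$ is a semilattice morphism $f\colon X\to Y$ such that (M1) $p_\alpha=p_\beta f$; (M2) $f(\operatorname{dom}\alpha_s)\subseteq\operatorname{dom}\beta_s$ and $\beta_s(f(e))=f(\alpha_s(e))$ for all $s\in S$ and $e\in\operatorname{dom}\alpha_s$. $\widehat{\mathcal{A}}(S)$ is the full subcategory of $\mathcal{A}(S)$ whose objects satisfy (A3a): for all $s\in S$, $\operatorname{dom}\alpha_s=\{y\in X\colon y\in\operatorname{dom}\alpha_t\cap p^{-1}(t^* )\text{ for some }t\le s\}$. $\widetilde{\mathcal{A}}(S)$ is the full subcategory whose objects satisfy (A3b): for all $s\in S$, $\operatorname{dom}\alpha_s=(\operatorname{dom}\alpha_s\cap p^{-1}(s^* ))^\downarrow$. The functor $\widehat F$ (extension of domains) sends an object $(\varphi,p,X)$ to $(\widehat\varphi,p,X)$, where $\operatorname{dom}\widehat\varphi_s=\{x\in X\colon x\in\operatorname{dom}\varphi_t\text{ for some }t\le s\}$ and $\widehat\varphi_s(x)=\varphi_t(x)$ for any $t\le s$ with $x\in\operatorname{dom}\varphi_t$. The functor $\widetilde F$ (restriction of domains) sends $(\varphi,p,X)$ to $(\widetilde\varphi,p,X)$, where $\widetilde\varphi_s$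 is the restriction of $\varphi_s$ to $\{x\in\operatorname{dom}\varphi_s\colon p(x)=s^*\}^\downarrow$. Both functors leave the underlying semilattice maps of morphisms unchanged. *)

(* Defs.v *)
From HB Require Import structures.
From mathcomp Require Import all_boot all_order.
From mathcomp Require Import boolp classical_sets.

Set Implicit Arguments.
Unset Strict Implicit.
Unset Printing Implicit Defensive.

Import Order.TTheory.
Local Open Scope classical_set_scope.
Local Open Scope order_scope.
Local Open Scope group_scope.

Record category := Category {
  obj :> Type;
  hom : obj -> obj -> Type;
  idm : forall a, hom a a;
  compm : forall a b c, hom b c -> hom a b -> hom a c;
  compm1l : forall a b (f : hom a b), compm (idm b) f = f;
  compm1r : forall a b (f : hom a b), compm f (idm a) = f;
  compmA : forall a b c d (h : hom c d) (g : hom b c) (f : hom a b),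
    compm h (compm g f) = compm (compm h g) f }.

Arguments hom {c} a b : rename.
Arguments idm {c} a : rename.
Arguments compm {c a b c0} g f : rename.

Record functor (C D : category) := Functor {
  fobj :> C -> D;
  fmap : forall a b : C, hom a b -> hom (fobj a) (fobj b);
  fmap_id : forall a, fmap (idm a) = idm (fobj a);
  fmap_comp : forall a b c (g : hom b c) (f : hom a b),
    fmap (compm g f) = compm (fmap g) (fmap f) }.

Arguments fmap {C D} F {a b} f : rename.

Definition functor_id (C : category) : functor C C.
Proof. by exists id (fun _ _ f => f). Defined.

Definition functor_comp (C D E : category)
  (G : functor D E) (F : functor C D) : functor C E.
Proof.
exists (fun a => G (F a)) (fun _ _ f => fmap G (fmap F f)).
- by move=> a; rewrite !fmap_id.
- by move=> a b c g f; rewrite !fmap_comp.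
Defined.

(* F is left adjoint to G: a bijection Hom(F a, b) -> Hom(a, G b),
   natural in a and b. *)
Definition left_adjoint (C D : category)
    (F : functor C D) (G : functor D C) : Prop :=
  exists phi : forall (a : C) (b : D), hom (F a) b -> hom a (G b),
    (forall a b, bijective (phi a b)) /\
    (forall (a a' : C) (b b' : D)
        (h : hom a' a) (g : hom (F a) b) (k : hom b b'),
      phi a' b' (compm k (compm g (fmap F h))) =
      compm (fmap G k) (compm (phi a b g) h)).

Definition right_adjoint (C D : category)
    (F : functor C D) (G : functor D C) : Prop := left_adjoint G F.

Definition mutually_inverse (C D : category)
    (F : functor C D) (G : functor D C) : Prop :=
  functor_comp G F = functor_id C /\ functor_comp F G = functor_id D.

Definition full_subcategory (C : category) (P : C -> Prop) : category.
Proof.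
exists {a : C | P a} (fun a b => hom (sval a) (sval b))
  (fun a => idm (sval a)) (fun _ _ _ g f => compm g f).
- by move=> *; apply: compm1l.
- by move=> *; apply: compm1r.
- by move=> *; apply: compmA.
Defined.

Definition inclusion (C : category) (P : C -> Prop) :
  functor (full_subcategory P) C.
Proof. by exists (fun a => sval a) (fun _ _ f => f). Defined.

HB.mixin Record Semigroup_isRestriction S of Semigroup S := {
  star : S -> S;
  plus : S -> S;
  mulplus : forall x, plus x * x = x;
  plusC : forall x y, plus x * plus y = plus y * plus x;
  plusM : forall x y, plus (plus x * y) = plus x * plus y;
  plus_ample : forall x y, plus (x * y) * x = x * plus y;
  mulstar : forall x, x * star x = x;
  starC : forall x y, star x * star y = star y * star x;
  starM : forall x y, star (x * star y) = star x * star y;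
  star_ample : forall x y, y * star (x * y) = star x * y;
  star_plus : forall x, star (plus x) = plus x;
  plus_star : forall x, plus (star x) = star x }.

#[short(type="restrictionSemigroupType")]
HB.structure Definition RestrictionSemigroup :=
  {S of Semigroup_isRestriction S & Semigroup S}.

Definition projection (S : restrictionSemigroupType) : set S := range star.
Arguments projection : clear implicits.

Definition natle (S : restrictionSemigroupType) (s t : S) : Prop :=
  exists2 e, projection S e & s = e * t.

Section RestrictionTheory.
Variable S : restrictionSemigroupType.
Implicit Types s t e f : S.

Lemma projection_star s : projection S (star s). Proof. by exists s. Qed.

Lemma projectionE : projection S = range plus.
Proof.
apply/seteqP; split => _ [x _ <-].
- by exists (star x) => //; rewrite plus_star.
- by exists (plus x) => //; rewrite star_plus.
Qed.

Lemma projection_plus s : projection S (plus s).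
Proof. by rewrite projectionE; exists s. Qed.

Lemma star_proj e : projection S e -> star e = e.
Proof.
by case=> x _ <-; rewrite -[X in star X]plus_star star_plus plus_star.
Qed.

Lemma plus_proj e : projection S e -> plus e = e.
Proof. by case=> x _ <-; rewrite plus_star. Qed.

Lemma mulpp e : projection S e -> e * e = e.
Proof. by move=> Pe; rewrite -[X in _ * X]star_proj// mulstar. Qed.

Lemma mulpC e f : projection S e -> projection S f -> e * f = f * e.
Proof. by move=> /star_proj <- /star_proj <-; rewrite starC. Qed.

Lemma projectionM e f :
  projection S e -> projection S f -> projection S (e * f).
Proof.
by move=> /star_proj <- /star_proj <-; rewrite -starM; apply: projection_star.
Qed.

Lemma star_mul s t : star (s * t) = star (star s * t).
Proof. by rewrite -star_ample starM -starC -starM -mulgA mulstar. Qed.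

Lemma natle_refl s : natle s s.
Proof.
by exists (plus s); [exact: projection_plus | rewrite mulplus].
Qed.

Lemma natle_trans s t u : natle s t -> natle t u -> natle s u.
Proof.
move=> [e Pe ->] [f Pf ->]; exists (e * f); last by rewrite mulgA.
exact: projectionM.
Qed.

Lemma natle_star s t : natle s t -> s = t * star s.
Proof. by move=> [e Pe ->]; rewrite star_ample (star_proj Pe). Qed.

Lemma natle_mulr e s : projection S e -> natle (s * e) s.
Proof.
move=> Pe; exists (plus (s * e)); first exact: projection_plus.
by rewrite plus_ample plus_proj.
Qed.

Lemma natle_mul s' s t' t : natle s' s -> natle t' t -> natle (s' * t') (s * t).
Proof.
move=> [e Pe ->] [f Pf ->]; exists (e * plus (s * f)).
  by apply: projectionM => //; exact: projection_plus.
by rewrite -!mulgA (mulgA (plus _)) plus_ample (plus_proj Pf) !mulgA.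
Qed.

Lemma natle_starS s t : natle s t -> natle (star s) (star t).
Proof.
move=> /natle_star st; exists (star s); first exact: projection_star.
by rewrite starC -starM -st.
Qed.

Lemma natle_plusS s t : natle s t -> natle (plus s) (plus t).
Proof.
move=> [e Pe ->]; exists e => //.
by rewrite -{1}(plus_proj Pe) plusM (plus_proj Pe).
Qed.

Lemma natle_proj s e : projection S e -> natle s e -> projection S s.
Proof. by move=> Pe [f Pf ->]; exact: projectionM. Qed.

Lemma natle_compat_plus s t u :
  natle t s -> natle u s -> plus u * t = plus t * u.
Proof.
move=> [e Pe ->] [f Pf ->].
have pl g : projection S g -> plus (g * s) = g * plus s.
  by move=> Pg; rewrite -{1}(plus_proj Pg) plusM (plus_proj Pg).
rewrite !pl// -!mulgA (mulgA (plus s) e) (mulgA (plus s) f).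
rewrite -(mulpC Pe (projection_plus s)) -(mulpC Pf (projection_plus s)).
by rewrite -!mulgA mulplus !mulgA (mulpC Pe Pf).
Qed.

Lemma natle_compat s t u : natle t s -> natle u s -> t * star u = u * star t.
Proof.
move=> /natle_star ts /natle_star us.
by rewrite {1}ts {2}us -!mulgA starC.
Qed.

End RestrictionTheory.

Definition premorphism (S T : restrictionSemigroupType) (phi : S -> T) : Prop :=
  [/\ forall s t, natle (phi s * phi t) (phi (s * t)),
      forall s, natle (star (phi s)) (phi (star s)) &
      forall s, natle (plus (phi s)) (phi (plus s))].

(* P(S) as a meet-semilattice, ordered by e <= f iff e = e f. *)
Definition proj (S : restrictionSemigroupType) : Type :=
  set_type (projection S).

Fact proj_display : Order.disp_t. Proof. exact: (Order.Disp tt tt). Qed.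

Section ProjSemilattice.
Variable S : restrictionSemigroupType.

HB.instance Definition _ := SubType.on (proj S).
HB.instance Definition _ := [Choice of proj S by <:].

Lemma projP (e : proj S) : projection S (val e).
Proof. exact: set_mem (valP e). Qed.

Definition Proj (e : S) (Pe : projection S e) : proj S := exist _ e (mem_set Pe).

Definition sstar (s : S) : proj S := Proj (projection_star s).

Definition proj_meet (e f : proj S) : proj S :=
  Proj (projectionM (projP e) (projP f)).

Definition proj_le (e f : proj S) : bool := proj_meet e f == e.

Fact proj_lexx : reflexive proj_le.
Proof. by move=> e; apply/eqP/val_inj; exact/mulpp/projP. Qed.

Fact proj_le_anti : antisymmetric proj_le.
Proof.
move=> e f /andP[/eqP ef /eqP fe]; rewrite -ef -[RHS]fe.
by apply/val_inj/mulpC; exact: projP.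
Qed.

Fact proj_le_trans : transitive proj_le.
Proof.
move=> f e g /eqP/(congr1 val)/= ef /eqP/(congr1 val)/= fg.
by apply/eqP/val_inj => /=; rewrite -ef -mulgA fg.
Qed.

HB.instance Definition _ := Order.Le_isPOrder.Build proj_display (proj S)
  proj_lexx proj_le_anti proj_le_trans.

Fact proj_lexI (e f g : proj S) : (e <= proj_meet f g) = (e <= f) && (e <= g).
Proof.
rewrite /Order.le /= /proj_le -!val_eqE /=.
apply/eqP/andP => [efg|[/eqP ef /eqP eg]]; last by rewrite mulgA ef eg.
have Pf := projP f; have Pg := projP g.
split; apply/eqP; rewrite -{1}efg -!mulgA.
- by rewrite (mulgA (val f)) (mulpC Pf Pg) -!mulgA (mulpp Pf) (mulpC Pg Pf).
- by rewrite (mulpp Pg).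
Qed.

HB.instance Definition _ :=
  Order.POrder_isMeetSemilattice.Build proj_display (proj S) proj_lexI.

End ProjSemilattice.

Lemma leproj (S : restrictionSemigroupType) (e f : proj S) :
  (e <= f) <-> val e * val f = val e.
Proof.
by rewrite /Order.le /= /proj_le -val_eqE /=; split => [/eqP|/eqP].
Qed.

(* A partial bijection of X is represented by its graph. *)
Record pbij (X : Type) := PBij {
  graph :> X -> X -> Prop;
  graph_fun : forall x y z, graph x y -> graph x z -> y = z;
  graph_inj : forall x y z, graph x z -> graph y z -> x = y }.

Section SymmetricInverse.
Variable X : Type.
Implicit Types a b c : pbij X.

Lemma pbij_ext a b : (forall x y, a x y <-> b x y) -> a = b.
Proof.
case: a b => [a af ai] [b bf bi] /= ab.
have E : a = b by apply/funext => x; apply/funext => y; apply/propext.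
by case: _ / E in bf bi ab *; congr PBij; apply: Prop_irrelevance.
Qed.

HB.instance Definition _ := gen_eqMixin (pbij X).
HB.instance Definition _ := gen_choiceMixin (pbij X).

Definition dom a : set X := [set x | exists y, a x y].
Definition ran a : set X := [set y | exists x, a x y].

(* Composed from right to left: b is applied first. *)
Definition pbij_comp a b : pbij X.
Proof.
exists (fun x z => exists2 y, b x y & a y z).
- move=> x z z' [y xy yz] [y' xy' yz'].
  by rewrite -(graph_fun xy xy') in yz'; exact: graph_fun yz yz'.
- move=> x x' z [y xy yz] [y' xy' yz'].
  by rewrite -(graph_inj yz yz') in xy'; exact: graph_inj xy xy'.
Defined.

Definition pbij_inv a : pbij X.
Proof.
exists (fun x y => a y x).
- by move=> x y z; exact: graph_inj.
- by move=> x y z; exact: graph_fun.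
Defined.

Definition pbij_restrict a (D : set X) : pbij X.
Proof.
exists (fun x y => D x /\ a x y).
- by move=> x y z [_ xy] [_ xz]; exact: graph_fun xy xz.
- by move=> x y z [_ xz] [_ yz]; exact: graph_inj xz yz.
Defined.

Fact pbij_compA : associative pbij_comp.
Proof.
move=> a b c; apply: pbij_ext => x y; split.
- by move=> [z [t xt tz] zy]; exists t => //; exists z.
- by move=> [t xt [z tz zy]]; exists z => //; exists t.
Qed.

HB.instance Definition _ := isSemigroup.Build (pbij X) pbij_compA.

Definition pbij_star a : pbij X := pbij_comp (pbij_inv a) a.
Definition pbij_plus a : pbij X := pbij_comp a (pbij_inv a).

Lemma pbij_starE a x y : pbij_star a x y <-> x = y /\ dom a x.
Proof.
split=> [[z xz yz]|[<- [z xz]]]; last by exists z.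
by split; [exact: graph_inj xz yz | exists z].
Qed.

Lemma pbij_plusE a x y : pbij_plus a x y <-> x = y /\ ran a x.
Proof.
split=> [[z xz yz]|[<- [z xz]]]; last by exists z.
by split; [exact: graph_fun (xz : a z x) yz | exists z].
Qed.

Fact pbij_mulplus a : pbij_plus a * a = a.
Proof.
apply: pbij_ext => x y; split; first by move=> [z xz /pbij_plusE[<-]].
by move=> xy; exists y => //; apply/pbij_plusE; split=> //; exists x.
Qed.

Fact pbij_mulstar a : a * pbij_star a = a.
Proof.
apply: pbij_ext => x y; split; first by move=> [z /pbij_starE[<-]].
by move=> xy; exists x => //; apply/pbij_starE; split=> //; exists y.
Qed.

Fact pbij_plusC a b : pbij_plus a * pbij_plus b = pbij_plus b * pbij_plus a.
Proof.
by apply: pbij_ext => x y; split => -[z /pbij_plusE[<- ?] /pbij_plusE[<- ?]];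
  exists x; apply/pbij_plusE.
Qed.

Fact pbij_starC a b : pbij_star a * pbij_star b = pbij_star b * pbij_star a.
Proof.
by apply: pbij_ext => x y; split => -[z /pbij_starE[<- ?] /pbij_starE[<- ?]];
  exists x; apply/pbij_starE.
Qed.

Fact pbij_plusM a b : pbij_plus (pbij_plus a * b) = pbij_plus a * pbij_plus b.
Proof.
apply: pbij_ext => x y; split.
- move=> /pbij_plusE[<- [z [t zt /pbij_plusE[tx rt]]]]; rewrite tx in zt rt.
  by exists x; apply/pbij_plusE; split=> //; exists z.
- move=> [z /pbij_plusE[<- [t tx]] /pbij_plusE[<- rx]].
  by apply/pbij_plusE; split=> //; exists t, x => //; apply/pbij_plusE.
Qed.

Fact pbij_starM a b : pbij_star (a * pbij_star b) = pbij_star a * pbij_star b.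
Proof.
apply: pbij_ext => x y; split.
- move=> /pbij_starE[<- [z [t /pbij_starE[<- dx] xz]]].
  by exists x; apply/pbij_starE; split=> //; exists z.
- move=> [z /pbij_starE[<- dx] /pbij_starE[<- [t xt]]].
  by apply/pbij_starE; split=> //; exists t, x => //; apply/pbij_starE.
Qed.

Fact pbij_plus_ample a b : pbij_plus (a * b) * a = a * pbij_plus b.
Proof.
apply: pbij_ext => x y; split.
- move=> [z xz /pbij_plusE[<- [t [u tu uz]]]].
  rewrite (graph_inj xz uz); exists u => //.
  by apply/pbij_plusE; split=> //; exists t.
- move=> [z /pbij_plusE[<- [t tx]] xy].
  by exists y => //; apply/pbij_plusE; split=> //; exists t, x.
Qed.

Fact pbij_star_ample a b : b * pbij_star (a * b) = pbij_star a * b.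
Proof.
apply: pbij_ext => x y; split.
- move=> [z /pbij_starE[<- [t [u xu ut]]] xy]; exists y => //.
  by apply/pbij_starE; split=> //; exists t; rewrite (graph_fun xy xu).
- move=> [z xz /pbij_starE[<- [t zt]]]; exists x => //.
  by apply/pbij_starE; split=> //; exists t, z.
Qed.

Fact pbij_star_plus a : pbij_star (pbij_plus a) = pbij_plus a.
Proof.
apply: pbij_ext => x y; split.
- by move=> /pbij_starE[<- [z /pbij_plusE[_ rx]]]; apply/pbij_plusE.
- move=> /pbij_plusE[<- rx]; apply/pbij_starE; split=> //.
  by exists x; apply/pbij_plusE.
Qed.

Fact pbij_plus_star a : pbij_plus (pbij_star a) = pbij_star a.
Proof.
apply: pbij_ext => x y; split.
- by move=> /pbij_plusE[<- [z /pbij_starE[-> rx]]]; apply/pbij_starE.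
- move=> /pbij_starE[<- rx]; apply/pbij_plusE; split=> //.
  by exists x; apply/pbij_starE.
Qed.

HB.instance Definition _ := Semigroup_isRestriction.Build (pbij X)
  pbij_mulplus pbij_plusC pbij_plusM pbij_plus_ample
  pbij_mulstar pbij_starC pbij_starM pbij_star_ample
  pbij_star_plus pbij_plus_star.

Lemma natle_pbijP a b : natle a b <-> forall x y, a x y -> b x y.
Proof.
split=> [[e Pe ->] x y [z xz zy]|ab].
  case: Pe => c _ ec; rewrite -ec in zy.
  by have /pbij_starE[<-] := zy.
exists (plus a); first exact: projection_plus.
apply: pbij_ext => x y; split=> [xy|[z xz /pbij_plusE[<- [t tz]]]].
- by exists y; [exact: ab | apply/pbij_plusE; split=> //; exists x].
- by rewrite (graph_inj xz (ab _ _ tz)).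
Qed.

End SymmetricInverse.

Definition down d (X : porderType d) (B : set X) : set X :=
  [set x | exists2 b, B b & x <= b].

Definition order_ideal d (X : porderType d) (A : set X) : Prop :=
  forall x y, A y -> x <= y -> A x.

Definition order_iso d (X : porderType d) (a : pbij X) : Prop :=
  forall x y x' y', a x x' -> a y y' -> (x <= y) = (x' <= y').

Definition meet_morphism d d'
    (X : meetSemilatticeType d) (Y : meetSemilatticeType d') (f : X -> Y) :=
  {morph f : x y / Order.meet x y}.

Record A_axioms d (S : restrictionSemigroupType) (X : meetSemilatticeType d)
    (alpha : S -> pbij X) (p : X -> proj S) : Prop := AAxioms {
  A_proj : meet_morphism p;
  A_premorphism : premorphism alpha;
  A1 : forall s, order_ideal (dom (alpha s)) /\ order_ideal (ran (alpha s));
  A2 : forall s, order_iso (alpha s);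
  A3 : forall e : proj S,
    down (p @^-1` [set e]) `<=` dom (alpha (val e)) /\
    dom (alpha (val e)) `<=` p @^-1` (down [set e]);
  A4 : forall s, dom (alpha s) `&` p @^-1` [set sstar s] !=set0 }.

Record A_obj d (S : restrictionSemigroupType) := AObj {
  A_sort :> meetSemilatticeType d;
  A_act : S -> pbij A_sort;
  A_map : A_sort -> proj S;
  A_objP : A_axioms A_act A_map }.

Arguments A_act {d S} a s : rename.
Arguments A_map {d S} a x : rename.

(* M2 says that beta_s (f x) is defined and equal to f (alpha_s x) for x in
   dom alpha_s. *)
Record A_hom_axioms d (S : restrictionSemigroupType) (a b : A_obj d S)
    (f : a -> b) : Prop := AHomAxioms {
  M_meet : meet_morphism f;
  M1 : A_map a = A_map b \o f;
  M2_dom : forall s, f @` dom (A_act a s) `<=` dom (A_act b s);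
  M2 : forall s x y, A_act a s x y -> A_act b s (f x) (f y) }.

Record A_hom d (S : restrictionSemigroupType) (a b : A_obj d S) := AHom {
  A_fun :> a -> b;
  A_homP : A_hom_axioms A_fun }.

Section CategoryA.
Variables (d : Order.disp_t) (S : restrictionSemigroupType).

Lemma A_hom_ext (a b : A_obj d S) (f g : A_hom a b) : f =1 g -> f = g.
Proof.
case: f g => [f fP] [g gP] /= /funext fg.
by case: _ / fg in gP *; congr AHom; apply: Prop_irrelevance.
Qed.

Lemma A_hom_mk (a b : A_obj d S) (f : a -> b) :
  meet_morphism f -> A_map a = A_map b \o f ->
  (forall s x y, A_act a s x y -> A_act b s (f x) (f y)) -> A_hom_axioms f.
Proof.
move=> fI fp fM; split=> // s _ [x [y xy] <-].
by exists (f y); exact: fM.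
Qed.

Definition A_id (a : A_obj d S) : A_hom a a.
Proof. by exists id; apply: A_hom_mk. Defined.

Definition A_comp (a b c : A_obj d S) (g : A_hom b c) (f : A_hom a b) :
  A_hom a c.
Proof.
exists (g \o f); apply: A_hom_mk.
- by move=> x y /=; rewrite (M_meet (A_homP f)) (M_meet (A_homP g)).
- by rewrite (M1 (A_homP f)) (M1 (A_homP g)).
- by move=> s x y xy; apply/(M2 (A_homP g))/(M2 (A_homP f)).
Defined.

Definition A_category : category.
Proof.
by exists (A_obj d S) (@A_hom d S) A_id A_comp; move=> *; apply: A_hom_ext.
Defined.

Definition A3a (a : A_obj d S) : Prop := forall s,
  dom (A_act a s) = [set y | exists2 t, natle t s &
    (dom (A_act a t) `&` A_map a @^-1` [set sstar t]) y].

Definition A3b (a : A_obj d S) : Prop := forall s,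
  dom (A_act a s) = down (dom (A_act a s) `&` A_map a @^-1` [set sstar s]).

Definition Ahat_category : category := @full_subcategory A_category A3a.
Definition Atilde_category : category := @full_subcategory A_category A3b.

Definition Ihat : functor Ahat_category A_category := @inclusion A_category A3a.
Definition Itilde : functor Atilde_category A_category :=
  @inclusion A_category A3b.

Section ObjTheory.
Variable a : A_obj d S.
Implicit Types (s t u : S) (e : proj S) (x y z : a).
Local Notation alpha := (A_act a).
Local Notation p := (A_map a).

Lemma A_mapS x y : x <= y -> p x <= p y.
Proof. by move=> /meet_idPl <-; rewrite (A_proj (A_objP a)) leIr. Qed.

Lemma A_actM s t x y z : alpha t x y -> alpha s y z -> alpha (s * t) x z.
Proof.
move=> xy yz; have [/(_ s t) /natle_pbijP st _ _] := A_premorphism (A_objP a).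
by apply: st; exists y.
Qed.

Lemma A_act_star s x y : alpha s x y -> alpha (star s) x x.
Proof.
move=> xy; have [_ /(_ s) /natle_pbijP ss _] := A_premorphism (A_objP a).
by apply/ss/pbij_starE; split=> //; exists y.
Qed.

Lemma A_act_plus s x y : alpha s x y -> alpha (plus s) y y.
Proof.
move=> xy; have [_ _ /(_ s) /natle_pbijP ss] := A_premorphism (A_objP a).
by apply/ss/pbij_plusE; split=> //; exists x.
Qed.

Lemma A_act_proj s x y : projection S s -> alpha s x y -> x = y.
Proof.
move=> Ps xy; have := A_act_star xy; rewrite star_proj// => xx.
exact: graph_fun xx xy.
Qed.

Lemma A_act_id x : alpha (val (p x)) x x.
Proof.
have [sub _] := A3 (A_objP a) (p x).
have [|y xy] := sub x; first by exists x.
by have E := A_act_proj (projP (p x)) xy; rewrite -E in xy.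
Qed.

Lemma A_act_le e x : alpha (val e) x x -> p x <= e.
Proof.
move=> ex; have [_ sub] := A3 (A_objP a) e.
by have [|_ /= ->] := sub x; first by exists x.
Qed.

Lemma A_le_star s x y : alpha s x y -> val (p x) * star s = val (p x).
Proof. by move=> /A_act_star xy; apply/(@leproj S _ (sstar s))/A_act_le. Qed.

Lemma A_le_plus s x y : alpha s x y -> val (p y) * plus s = val (p y).
Proof.
move=> /A_act_plus xy.
exact/(@leproj S _ (Proj (projection_plus s)))/A_act_le.
Qed.

Lemma A_map_act s x y :
  alpha s x y -> val (p y) = plus (s * val (p x)) /\
                 val (p x) = star (val (p y) * s).
Proof.
move=> xy; have Px := projP (p x); have Py := projP (p y).
have /A_le_plus fse := A_actM (A_act_id x) xy.
have /A_le_star efs := A_actM xy (A_act_id y).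
have sfe : s * val (p x) = val (p y) * (s * val (p x)).
  rewrite -{1}efs (mulpC Px) ?mulgA; last exact: projection_star.
  by rewrite star_ample (star_proj Py).
have fse' : val (p y) * s = (val (p y) * s) * val (p x).
  rewrite -{1}fse -mulgA plus_ample (plus_proj Px).
  by rewrite mulgA.
split.
- by rewrite sfe -[in RHS](plus_proj Py) plusM (plus_proj Py) fse.
- rewrite fse' -{2}(star_proj Px) starM (star_proj Px).
  by rewrite (mulpC (projection_star _) Px) efs.
Qed.

Lemma A_act_compat s t u x y z :
  natle t s -> natle u s -> alpha t x y -> alpha u x z -> y = z.
Proof.
move=> ts us xy xz.
have := A_actM (A_act_star xz) xy; have := A_actM (A_act_star xy) xz.
by rewrite (natle_compat ts us) => xz' xy'; exact: graph_fun xy' xz'.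
Qed.

Lemma A_act_compat_inv s t u x y z :
  natle t s -> natle u s -> alpha t x z -> alpha u y z -> x = y.
Proof.
move=> ts us xz yz.
have := A_actM xz (A_act_plus yz); have := A_actM yz (A_act_plus xz).
rewrite (natle_compat_plus ts us) => yz' xz'; exact: graph_inj xz' yz'.
Qed.

Lemma A_dom_ideal s x y z : x <= y -> alpha s y z -> exists z', alpha s x z'.
Proof.
move=> xy yz; have [di _] := A1 (A_objP a) s.
by apply: (di x y) xy; exists z.
Qed.

Lemma A_ran_ideal s x y z : y <= z -> alpha s x z -> exists x', alpha s x' y.
Proof.
move=> yz xz; have [_ ri] := A1 (A_objP a) s.
by apply: (ri y z) yz; exists x.
Qed.

(* The union of the graphs of alpha_t over t <= s. *)
Definition hat_act (s : S) : pbij a.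
Proof.
exists (fun x y => exists2 t, natle t s & alpha t x y).
- by move=> x y z [t ts xy] [u us xz]; exact: A_act_compat ts us xy xz.
- by move=> x y z [t ts xz] [u us yz]; exact: A_act_compat_inv ts us xz yz.
Defined.

Lemma hat_axioms : A_axioms hat_act p.
Proof.
split.
- exact: A_proj (A_objP a).
- split.
  + move=> s t; apply/natle_pbijP => x z [y [t' t't xy] [s' s's yz]].
    by exists (s' * t'); [exact: natle_mul | exact: A_actM xy yz].
  + move=> s; apply/natle_pbijP => x z /pbij_starE[<- [y [t ts xy]]].
    by exists (star t); [exact: natle_starS | exact: A_act_star xy].
  + move=> s; apply/natle_pbijP => x z /pbij_plusE[<- [y [t ts xy]]].
    by exists (plus t); [exact: natle_plusS | exact: A_act_plus xy].
- move=> s; split=> x y.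
  + move=> [z [t ts yz]] xy; have [z' xz'] := A_dom_ideal xy yz.
    by exists z', t.
  + move=> [z [t ts zy]] xy; have [z' xz'] := A_ran_ideal xy zy.
    by exists z', t.
- move=> s x y x' y' [t ts xx'] [u us yy']; apply/idP/idP => le.
  + have [x'' xx''] := A_dom_ideal le yy'.
    rewrite (A_act_compat ts us xx' xx'').
    by rewrite -(A2 (A_objP a) xx'' yy').
  + have [x'' xx''] := A_ran_ideal le yy'.
    rewrite (A_act_compat_inv ts us xx' xx'').
    by rewrite (A2 (A_objP a) xx'' yy').
- move=> e; have [sub1 sub2] := A3 (A_objP a) e; split=> x.
  + move=> /sub1[y xy]; exists y, (val e) => //; exact: natle_refl.
  + move=> [y [t te xy]].
    have Pt := natle_proj (projP e) te.
    have E := A_act_proj Pt xy; rewrite -E in xy.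
    exists e => //.
    apply: (@le_trans _ _ (Proj Pt)); first exact: A_act_le.
    apply/leproj => /=; case: te => f Pf ->.
    by rewrite -mulgA (mulpp (projP e)).
- move=> s; have [x [[y xy] px]] := A4 (A_objP a) s.
  by exists x; split=> //; exists y, s => //; exact: natle_refl.
Qed.

Definition tilde_dom (s : S) : set a :=
  down [set x | dom (alpha s) x /\ p x = sstar s].

Definition tilde_act (s : S) : pbij a := pbij_restrict (alpha s) (tilde_dom s).

Lemma tilde_domS s x y : x <= y -> tilde_dom s y -> tilde_dom s x.
Proof. by move=> xy [z zP yz]; exists z => //; exact: le_trans yz. Qed.

Lemma tilde_domP s x : tilde_dom s x -> exists y, tilde_act s x y.
Proof.
move=> xs; have [z [[t zt] _] xz] := xs.
by have [y xy] := A_dom_ideal xz zt; exists y.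
Qed.

Lemma tilde_axioms : A_axioms tilde_act p.
Proof.
have ap := A_objP a.
split.
- exact: A_proj ap.
- split.
  + move=> s t; apply/natle_pbijP => x z [y [xt xy] [ys yz]].
    split; last exact: A_actM xy yz.
    have [x0 [[y0 xy0] px0] lex] := xt.
    have [y1 [[z1 yz1] py1] ley] := ys.
    have ley0 : y <= y0 by rewrite -(A2 ap xy xy0).
    have [w ww] := A_ran_ideal (leIl y0 y1) xy0.
    have [z2 wz2] := A_dom_ideal (leIr y1 y0) yz1.
    exists w; last by rewrite (A2 ap xy ww) lexI ley0.
    split; first by exists z2; exact: A_actM ww wz2.
    apply/val_inj; have [_ ->] := A_map_act ww.
    have [E _] := A_map_act xy0; rewrite px0 /= mulstar in E.
    rewrite (A_proj ap) /= E py1 /=.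
    rewrite (mulpC (projection_plus _) (projection_star _)).
    by rewrite -mulgA mulplus -star_mul.
  + move=> s; apply/natle_pbijP => x z /pbij_starE[<- [y [xs xy]]].
    have [x0 [[y0 xy0] px0] lex] := xs.
    split; last exact: A_act_star xy.
    exists x0 => //; split; first by exists x0; exact: A_act_star xy0.
    by rewrite px0; apply/val_inj; rewrite /= (star_proj (projection_star s)).
  + move=> s; apply/natle_pbijP => x z /pbij_plusE[<- [y [ys yx]]].
    have [y0 [[x0 yx0] py0] ley] := ys.
    split; last exact: A_act_plus yx.
    exists x0; last by rewrite -(A2 ap yx yx0).
    split; first by exists x0; exact: A_act_plus yx0.
    apply/val_inj; have [-> _] := A_map_act yx0.
    by rewrite py0 /= mulstar star_plus.
- move=> s; split=> x y.
  + by move=> [z [ys yz]] xy; apply: tilde_domP; exact: tilde_domS xy ys.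
  + move=> [z [zs zy]] xy; have [t tx] := A_ran_ideal xy zy.
    exists t; split=> //; apply: tilde_domS zs.
    by rewrite (A2 ap tx zy).
- by move=> s x y x' y' [_ xx'] [_ yy']; exact: (A2 ap xx' yy').
- move=> e; have [sub1 sub2] := A3 ap e.
  have Ee : sstar (val e) = e by apply/val_inj/star_proj/projP.
  split=> x.
  + move=> [y /= py xy]; apply: tilde_domP; exists y => //.
    by split; [apply: sub1; exists y | rewrite Ee].
  + by move=> [y [_ xy]]; apply: sub2; exists y.
- move=> s; have [x [xd px]] := A4 ap s.
  by exists x; split=> //; apply: tilde_domP; exists x.
Qed.

Definition hat_obj : A_obj d S := AObj hat_axioms.
Definition tilde_obj : A_obj d S := AObj tilde_axioms.

Lemma hat_obj_A3a : A3a hat_obj.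
Proof.
move=> s; apply/seteqP; split=> x /=.
- move=> [y [t ts xy]]; have Px := projP (p x).
  exists (t * val (p x)).
    exact: natle_trans (natle_mulr _ Px) ts.
  split; last first.
    apply/val_inj => /=; have := starM t (val (p x)); rewrite (star_proj Px) => ->.
    by rewrite (mulpC (projection_star t) Px) (A_le_star xy).
  exists y, (t * val (p x)); first exact: natle_refl.
  exact: A_actM (A_act_id x) xy.
- move=> [t ts [[y [u ut xy]] _]]; exists y, u => //; exact: natle_trans ts.
Qed.

Lemma tilde_obj_A3b : A3b tilde_obj.
Proof.
move=> s; apply/seteqP; split=> x.
- move=> [y [[z [zs pz] xz] xy]]; exists z => //; split=> //.
  by apply: tilde_domP; exists z.
- by move=> [z [[y [zs zy]] _] xz]; apply: tilde_domP; exact: tilde_domS xz zs.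
Qed.

End ObjTheory.

Definition hat_hom (a b : A_obj d S) (f : A_hom a b) :
  A_hom (hat_obj a) (hat_obj b).
Proof.
apply: (@AHom _ _ (hat_obj a) (hat_obj b) (@A_fun _ _ a b f)).
apply: A_hom_mk.
- exact: M_meet (A_homP f).
- exact: M1 (A_homP f).
- by move=> s x y [t ts xy]; exists t => //; exact: M2 (A_homP f) _ _ _ xy.
Defined.

Lemma A_funS (a b : A_obj d S) (f : A_hom a b) x y : x <= y -> f x <= f y.
Proof. by move=> /meet_idPl <-; rewrite (M_meet (A_homP f)) leIr. Qed.

Definition tilde_hom (a b : A_obj d S) (f : A_hom a b) :
  A_hom (tilde_obj a) (tilde_obj b).
Proof.
apply: (@AHom _ _ (tilde_obj a) (tilde_obj b) (@A_fun _ _ a b f)).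
apply: A_hom_mk.
- exact: M_meet (A_homP f).
- exact: M1 (A_homP f).
- move=> s x y [[z [[t zt] pz] xz] xy].
  split; last exact: M2 (A_homP f) _ _ _ xy.
  exists (f z); last exact: A_funS.
  split; first by exists (f t); exact: M2 (A_homP f) _ _ _ zt.
  by rewrite -pz (M1 (A_homP f)).
Defined.

Definition Fhat : functor A_category Ahat_category.
Proof.
exists (fun a : A_category => exist _ (hat_obj a) (@hat_obj_A3a a)
          : Ahat_category)
       (fun a b f => hat_hom f).
- by move=> a; apply: A_hom_ext.
- by move=> a b c g f; apply: A_hom_ext.
Defined.

Definition Ftilde : functor A_category Atilde_category.
Proof.
exists (fun a : A_category => exist _ (tilde_obj a) (@tilde_obj_A3b a)
          : Atilde_category)
       (fun a b f => tilde_hom f).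
- by move=> a; apply: A_hom_ext.
- by move=> a b c g f; apply: A_hom_ext.
Defined.

End CategoryA.

(* Main.v *)
Require Import Defs.
From mathcomp Require Import all_boot all_order.
From mathcomp Require Import boolp classical_sets.

(** All objects related by the two functors have the same carrier and the same
    projection map, and all comparison morphisms between them are the identity
    of that carrier; only the domains of the partial bijections change. Write
    hat a and tilde a for the extension and the restriction of a. Always
    tilde a -> a -> hat a.

    Condition (A3a) says exactly that the action is monotone in s, so that
    extending the domains changes nothing (lemma [A3a_mono]): if x is in the
    domain of alpha_t and t <= s, then x is in the domain of alpha_(t p(x)),
    the element t p(x) lies below s and its star is p(x). Hence hat a -> a for
    such a, and this together with a -> hat a gives the reflection. Dually,
    (A3b) says that restricting the domains changes nothing, which gives the
    coreflection.

    The two adjunctions compose to one between the two subcategories, with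
    counit hat (tilde a) -> a and unit a -> tilde (hat a). Both are carried by
    the identity, so what remains is that the actions agree. Extension
    recovers what restriction removes since alpha_s x = alpha_(s p(x)) x and x
    lies over the star of s p(x) ([hat_tildeP]). Restriction removes what
    extension adds since a point over the star of s which lies in the domain
    of alpha_t for some t <= s forces t = s ([natle_star_eq]).

    The isomorphism in question is an equality of functors. An equality of
    functors is obtained from a natural transformation each of whose
    components is an identity up to an equality of objects ([functor_eqP]). *)

Set Implicit Arguments.
Unset Strict Implicit.
Unset Printing Implicit Defensive.

Import Order.TTheory.
Local Open Scope classical_set_scope.
Local Open Scope order_scope.
Local Open Scope group_scope.

Definition hom_of_eq (C : category) (a b : C) (e : a = b) : hom a b :=
  match e in _ = c return hom a c with erefl => idm a end.

Definition identity_mor (C : category) (a b : C) (h : hom a b) : Prop :=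
  exists e : a = b, h = hom_of_eq e.

(** Naturality with respect to identity components replaces the transport of
    morphisms along the equalities of objects. *)
Lemma functor_eqP (C D : category) (F G : functor C D)
    (h : forall a, hom (F a) (G a)) :
  (forall a, identity_mor (h a)) ->
  (forall a b (f : hom a b), compm (h b) (fmap F f) = compm (fmap G f) (h a)) ->
  F = G.
Proof.
case: F G h => [Fo Fm F1 FM] [Go Gm G1 GM] /= h hid hnat.
have E : Fo = Go by apply/funext => a; have [] := hid a.
case: _ / E in Gm G1 GM h hid hnat *.
have hE a : h a = idm (Fo a).
  by have [e ->] := hid a; rewrite (Prop_irrelevance e erefl).
have mE : Fm = Gm.
  apply: functional_extensionality_dep => a.
  apply: functional_extensionality_dep => b.
  apply: functional_extensionality_dep => f.
  by have := hnat a b f; rewrite !hE compm1l compm1r.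
case: _ / mE in G1 GM hnat *.
by congr Functor; apply: Prop_irrelevance.
Qed.

Section Adjunctions.
Variables (d : Order.disp_t) (S : restrictionSemigroupType).
Implicit Types (a b : A_obj d S) (s t : S).

(** The objects are spelled out as constructor applications over a common X
    and p, since an equality of abstract objects could not be split into an
    equality of actions. The morphism h already gives the inclusion of graphs
    opposite to the one assumed. *)
Lemma identity_morP (Q : A_category d S -> Prop) (X : meetSemilatticeType d)
    (p : X -> proj S) (alpha beta : S -> pbij X)
    (aP : A_axioms alpha p) (bP : A_axioms beta p)
    (Qa : Q (AObj aP)) (Qb : Q (AObj bP))
    (h : A_hom (AObj aP) (AObj bP)) :
  A_fun h =1 id -> (forall s x y, beta s x y -> alpha s x y) ->
  @identity_mor (full_subcategory Q) (exist _ _ Qa) (exist _ _ Qb) h.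
Proof.
move=> hid ba.
have E : alpha = beta.
  apply/funext => s; apply: pbij_ext => x y; split; last exact: ba.
  by move=> /(M2 (A_homP h)); rewrite !hid.
case: _ / E in bP Qb h hid ba *.
have E : aP = bP by exact: Prop_irrelevance.
case: _ / E in Qb h hid *.
rewrite (Prop_irrelevance Qb Qa); exists erefl.
by apply: A_hom_ext => x; rewrite hid.
Qed.

(** A premorphism satisfies alpha_t alpha_(p(x)) <= alpha_(t p(x)), and
    alpha_(p(x)) fixes x by (A3). With e the star of t, the star of t p(x)
    is e p(x), which equals p(x) as x lies in the domain of alpha_e. Thus
    t p(x) is the witness that (A3a) asks for. *)
Lemma A_act_restrict a t x y : A_act a t x y ->
  A_act a (t * val (A_map a x)) x y /\
  A_map a x = sstar (t * val (A_map a x)).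
Proof.
move=> xy; have Px := projP (A_map a x); split.
  exact: A_actM (A_act_id x) xy.
apply/val_inj => /=; have := starM t (val (A_map a x)).
rewrite (star_proj Px) => ->.
by rewrite (mulpC (projection_star t) Px) (A_le_star xy).
Qed.

Lemma A3a_mono a : A3a a ->
  forall s t x y, natle t s -> A_act a t x y -> A_act a s x y.
Proof.
move=> a3 s t x y ts xy; have [xy' px] := A_act_restrict xy.
have : dom (A_act a s) x.
  rewrite a3; exists (t * val (A_map a x)).
    exact: natle_trans (natle_mulr _ (projP _)) ts.
  by split=> //; exists y.
by move=> [z xz]; rewrite (A_act_compat ts (natle_refl s) xy xz).
Qed.

Lemma A3b_tilde_act a : A3b a ->
  forall s x y, A_act a s x y -> tilde_act a s x y.
Proof.
by move=> a3 s x y xy; split=> //; have : dom (A_act a s) x by [exists y];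
  rewrite a3.
Qed.

Lemma hat_tildeP a s x y :
  A_act a s x y -> hat_act (tilde_obj a) s x y.
Proof.
move=> xy; have [xy' px] := A_act_restrict xy.
exists (s * val (A_map a x)); first exact: natle_mulr (projP _).
by split=> //; exists x => //; split=> //; exists y.
Qed.

Lemma natle_star_eq s t : natle t s -> star s * star t = star s -> t = s.
Proof.
move=> /natle_star ts st.
by rewrite ts -[X in X * _]mulstar -mulgA st mulstar.
Qed.

Lemma tilde_hatP a s x y :
  tilde_act (hat_obj a) s x y -> A_act a s x y.
Proof.
move=> [[z [[w [t ts zw]] /= pz] xz] [u us xy]].
have E : t = s by apply: natle_star_eq ts _; have := A_le_star zw; rewrite pz.
rewrite E in zw; have [y' xy'] := A_dom_ideal xz zw.
by rewrite (A_act_compat us (natle_refl s) xy xy').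
Qed.

Definition to_hat a : A_hom a (hat_obj a).
Proof.
apply: (@AHom _ _ a (hat_obj a) id); apply: A_hom_mk => // s x y xy.
by exists s => //; exact: natle_refl.
Defined.

Definition of_hat a (a3 : A3a a) : A_hom (hat_obj a) a.
Proof.
apply: (@AHom _ _ (hat_obj a) a id); apply: A_hom_mk => // s x y [t ts].
exact: A3a_mono.
Defined.

Definition of_tilde a : A_hom (tilde_obj a) a.
Proof.
by apply: (@AHom _ _ (tilde_obj a) a id); apply: A_hom_mk => // s x y [].
Defined.

Definition to_tilde a (a3 : A3b a) : A_hom a (tilde_obj a).
Proof.
apply: (@AHom _ _ a (tilde_obj a) id); apply: A_hom_mk => // s x y.
exact: A3b_tilde_act.
Defined.

Lemma Fhat_left_adjoint : left_adjoint (Fhat d S) (Ihat d S).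
Proof.
exists (fun (a : A_category d S) (b : Ahat_category d S)
          (g : A_hom (hat_obj a) (sval b)) => A_comp g (to_hat a)).
split=> [a b|a a' b b' h g k]; last exact: A_hom_ext.
exists (fun f : A_hom a (sval b) => A_comp (of_hat (svalP b)) (hat_hom f));
  by move=> f; exact: A_hom_ext.
Qed.

Lemma Ftilde_right_adjoint : right_adjoint (Ftilde d S) (Itilde d S).
Proof.
exists (fun (a : Atilde_category d S) (b : A_category d S)
          (g : A_hom (sval a) b) => A_comp (tilde_hom g) (to_tilde (svalP a))).
split=> [a b|a a' b b' h g k]; last exact: A_hom_ext.
exists (fun f : A_hom (sval a) (tilde_obj b) => A_comp (of_tilde b) f);
  by move=> f; exact: A_hom_ext.
Qed.

(** The counit of the composite adjunction is an identity. *)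
Lemma Fhat_Ftilde_id :
  functor_comp (functor_comp (Fhat d S) (Itilde d S))
               (functor_comp (Ftilde d S) (Ihat d S)) = functor_id _.
Proof.
set GF := functor_comp _ _.
pose counit (a : Ahat_category d S) : hom (GF a) (functor_id _ a) :=
  A_comp (of_hat (svalP a)) (hat_hom (of_tilde (sval a))).
apply: (functor_eqP (h := counit)) => [|a b f]; last exact: A_hom_ext.
case=> -[X alpha p aP] a3; apply: identity_morP => // s x y.
exact: (@hat_tildeP (AObj aP)).
Qed.

(** The unit of the composite adjunction is an identity. *)
Lemma Ftilde_Fhat_id :
  functor_comp (functor_comp (Ftilde d S) (Ihat d S))
               (functor_comp (Fhat d S) (Itilde d S)) = functor_id _.
Proof.
set FG := functor_comp _ _.
pose unit (a : Atilde_category d S) : hom (functor_id _ a) (FG a) :=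
  A_comp (tilde_hom (to_hat (sval a))) (to_tilde (svalP a)).
apply/esym/(functor_eqP (h := unit)) => [|a b f]; last exact: A_hom_ext.
case=> -[X alpha p aP] a3; apply: identity_morP => // s x y.
exact: (@tilde_hatP (AObj aP)).
Qed.

End Adjunctions.

Theorem theorem6p2 (d : Order.disp_t) (S : restrictionSemigroupType) :
  [/\ left_adjoint (Fhat d S) (Ihat d S),
      right_adjoint (Ftilde d S) (Itilde d S) &
      mutually_inverse (functor_comp (Ftilde d S) (Ihat d S))
                       (functor_comp (Fhat d S) (Itilde d S))].
Proof.
split; first exact: Fhat_left_adjoint.
  exact: Ftilde_right_adjoint.
by split; [exact: Fhat_Ftilde_id | exact: Ftilde_Fhat_id].
Qed.
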